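(* Let $H=p^{1/4+o(1)}$ and $T=p^{1/2+o(1)}$, where $p$ is a prime, $p\to\infty$. Then for the interval $\mathcal{I}=\{1,\ldots,H\}$ and the multiplicative subgroup $\mathcal{G}\subseteq\mathbb{F}_p^*$ of order $T$, we have $$\left|\sum_{x\in\mathcal{I}}\sum_{\lambda\in\mathcal{G}}\chi(x+a\lambda)\right|\le HT\,p^{-5/48+o(1)}$$ uniformly over $a\in\mathbb{F}_p^*$ and nonprincipal multiplicative characters $\chi$ of $\mathbb{F}_p$.
   Context: $\mathbb{F}_p$ is the field of $p$ elements, represented by $\{0,\ldots,p-1\}$; integers are read modulo $p$ when used as elements of $\mathbb{F}_p$. A multiplicative character $\chi$ of $\mathbb{F}_p$ is extended by $\chi(0)=0$. Here $H$ is a positive integer and $T\mid p-1$, and $o(1)$ denotes a quantity tending to $0$ as $p\to\infty$. Explicitly, the assertion means: for every $\epsilon>0$ there are $\epsilon'>0$ and $p_0$ such that for all primes $p\ge p_0$, all positive integers $H$ with $p^{1/4-\epsilon'}\le H\le p^{1/4+\epsilon'}$, all subgroups $\mathcal{G}\subseteq\mathbb{F}_p^*$ of order $T$ with $p^{1/2-\epsilon'}\le T\le p^{1/2+\epsilon'}$, all $a\in\mathbb{F}_p^*$ and all nonprincipal $\chi$, the absolute value of the sum is at most $HTp^{-5/48+\epsilon}$. *)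

(* Defs.v *)
From HB Require Import structures.
From mathcomp Require Import all_boot all_order all_algebra all_fingroup.
From mathcomp Require Import all_classical all_reals all_analysis.
From mathcomp Require Import complex.

Set Implicit Arguments.
Unset Strict Implicit.
Unset Printing Implicit Defensive.

Import Order.TTheory GRing.Theory Num.Theory.

Local Open Scope ring_scope.
Local Open Scope complex_scope.

(* A character of the group 'F_p^* extended by 0 at 0.  Nonvanishing on
   'F_p^* is automatic, since chi x * chi x^-1 = chi 1 = 1 for x != 0. *)
Definition mult_char (R : realType) (p : nat) (chi : 'F_p -> R[i]) : Prop :=
  [/\ chi 0 = 0, chi 1 = 1 & {morph chi : x y / x * y}].

Definition principal_char (R : realType) (p : nat) : 'F_p -> R[i] :=
  fun x => if x == 0 then 0 else 1.

(* Main.v *)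
Require Import Defs.
From HB Require Import structures.
From mathcomp Require Import all_boot all_order all_algebra all_fingroup.
From mathcomp Require Import all_classical all_reals all_analysis.
From mathcomp Require Import complex.
From mathcomp Require Import ring lra.

Set Implicit Arguments.
Unset Strict Implicit.
Unset Printing Implicit Defensive.

Import Order.TTheory GRing.Theory Num.Theory.

Local Open Scope ring_scope.
Local Open Scope complex_scope.

(** Write N for the number of pairs (x, y) of integers of [1, H] whose ratio
x / y lies in G modulo p, and Phi(u) for the sum of chi(u + a l) over l in G.

The sum S to be bounded is at most the sum over x of |Phi(x)|, and |Phi| is
constant on the cosets of G.  Hence x may be replaced by all the products x m
with m in G, and Cauchy-Schwarz over the values u = x m leaves two second
moments: that of the number of representations u = x m, which is at most T N,
and that of Phi, which is at most p T by orthogonality.  The outcome is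
|S|^2 <= p N ([char_sum_sq_le]), and for H = p^(1/4),
T = p^(1/2) the square root of p H p^(1/24) is H T p^(-5/48): the theorem
amounts to N <= H p^(1/24 + o(1)).

Let r(K) be the number of reduced fractions with numerator and denominator at
most K that lie in G modulo p.  Sorting pairs by their greatest common divisor
g bounds N by the sum of the r(H / g) ([card_ratio_pairs_le]), and it remains
to show r(K) <= K p^(1/24 + o(1)) for K <= p^(1/4 + o(1)).  Two facts give this:

- r(K) r(L) <= r(K L) p^o(1) when K L < p ([card_fractionsM]): a product of two
  fractions of G is a fraction of G, and in spite of cancellations there are
  almost as many products as pairs of factors;
- r(M) <= 2 T (M^2 / p + 1) ([card_fractions_le]): for two fractions with the
  same residue modulo p, the cross product u v' - u' v is a multiple of p.

With M = K^2 they yield r(K) <= p^(1/4 + o(1)), which is enough when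
K >= p^(5/24); with M = K^3 they are enough for p^(1/8) <= K <= p^(5/24); and a
smaller K reduces to K^2.  The two ranges meet at K = p^(5/24), where both
estimates give r(K) / K <= p^(1/24 + o(1)); this determines the exponent.

The factors p^o(1) stem from the divisor bound ([divisor_bound]).  Once
y = p^(1/24) and x = p^eps' are introduced, all the bounds are monomials in x
and y, so that the exponents are handled by polynomial algebra. *)

(** * The divisor bound *)

Local Notation tau n := (size (divisors n)).

(** A divisor d of m n is recovered from gcd(d, m), which divides m, and the
cofactor d / gcd(d, m), which divides n. *)
Lemma tau_mul (m n : nat) : (0 < m)%N -> (0 < n)%N ->
  (tau (m * n) <= tau m * tau n)%N.
Proof.
move=> m0 n0; rewrite -(size_allpairs pair).
pose f d := (gcdn d m, d %/ gcdn d m)%N.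
have fK : cancel f (fun x => (x.1 * x.2)%N).
  by move=> d; rewrite /f /= mulnC divnK // dvdn_gcdl.
rewrite -(size_map f); apply: uniq_leq_size.
  by rewrite map_inj_uniq ?divisors_uniq //; exact: can_inj fK.
move=> _ /mapP[d d_mn ->].
move: d_mn; rewrite -dvdn_divisors ?muln_gt0 ?m0 // => d_mn.
apply: allpairs_f; first by rewrite -dvdn_divisors // dvdn_gcdr.
have g0 : (0 < gcdn d m)%N by rewrite gcdn_gt0 m0 orbT.
rewrite -dvdn_divisors // -(@Gauss_dvdr _ (m %/ gcdn d m)).
  rewrite -(dvdn_pmul2l g0) mulnA ![(gcdn d m * (_ %/ _))%N]mulnC.
  by rewrite !divnK ?dvdn_gcdl ?dvdn_gcdr.
have d0 : (0 < d)%N by apply: dvdn_gt0 d_mn; rewrite muln_gt0 m0.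
rewrite /coprime -(eqn_pmul2l g0) muln1 muln_gcdr.
by rewrite ![(gcdn d m * (_ %/ _))%N]mulnC !divnK ?dvdn_gcdl ?dvdn_gcdr.
Qed.

Lemma tau_primeX (q e : nat) : prime q -> (tau (q ^ e) <= e.+1)%N.
Proof.
move=> pq; rewrite -[leqRHS](size_iota 0) -[leqRHS](size_map (expn q)).
apply: uniq_leq_size; first exact: divisors_uniq.
move=> d; rewrite -dvdn_divisors ?expn_gt0 ?prime_gt0 //.
by case/(dvdn_pfactor _ _ pq) => i ie ->; apply: map_f; rewrite mem_iota.
Qed.

Lemma tau_le_prod (n : nat) : (0 < n)%N ->
  (tau n <= \prod_(f <- prime_decomp n) f.2.+1)%N.
Proof.
move=> n0; rewrite {1}(prod_prime_decomp n0).
have : all (fun f => prime f.1) (prime_decomp n).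
  by apply/allP => -[q e] /mem_prime_decomp[].
elim: (prime_decomp n) => [|f s IHs] /=; first by rewrite !big_nil.
case/andP => pf ps; rewrite !big_cons.
apply: (leq_trans (tau_mul _ _)).
- by rewrite expn_gt0 prime_gt0.
- rewrite big_seq prodn_cond_gt0 // => g /(allP ps) /prime_gt0 g0.
  by rewrite expn_gt0 g0.
- by apply: leq_mul; [exact: tau_primeX | exact: IHs].
Qed.

(** Any exponential beats e^k; splitting e into k steps of length e / k gives the
explicit constant k^k. *)
Lemma expS_le_exp2 (k e : nat) : (0 < k)%N -> (e.+1 ^ k <= k ^ k * 2 ^ e)%N.
Proof.
move=> k0; have le1 : (e.+1 <= k * 2 ^ (e %/ k))%N.
  apply: (leq_trans (ltn_ceil e k0)).
  by rewrite mulnC leq_pmul2l // ltn_expl.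
rewrite -(leq_exp2r _ _ k0) in le1; apply: (leq_trans le1).
by rewrite expnMn leq_mul2l -expnM leq_exp2l // leq_trunc_div orbT.
Qed.

(** The number of divisors is at most the product of the e + 1 over the prime
powers q^e in n.  A prime q >= 2^k already satisfies (e + 1)^k <= q^e, and each
of the fewer than 2^k smaller primes costs a factor k^k. *)
Lemma divisor_bound (k : nat) : (0 < k)%N ->
  exists C : nat, forall n, (0 < n)%N -> (tau n ^ k <= C * n)%N.
Proof.
move=> k0; exists ((k ^ k) ^ (2 ^ k))%N => n n0.
have kk0 : (0 < k ^ k)%N by rewrite expn_gt0 k0.
apply: (@leq_trans (\prod_(f <- prime_decomp n) f.2.+1 ^ k)).
  rewrite -(big_morph (fun x => x ^ k)%N (fun x y => expnMn x y k) (exp1n k)).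
  by rewrite leq_exp2r // tau_le_prod.
pose c q : nat := if (q < 2 ^ k)%N then (k ^ k)%N else 1%N.
apply: (@leq_trans (\prod_(f <- prime_decomp n) (c f.1 * f.1 ^ f.2))).
  rewrite big_seq [leqRHS]big_seq; apply: leq_prod => -[q e] /=.
  case/mem_prime_decomp => pq _ _; rewrite /c; case: ltnP => [_ | leq].
    apply: (leq_trans (expS_le_exp2 e k0)).
    rewrite leq_mul2l; apply/orP; right.
    by case: e => [|e]; rewrite ?expn0 // leq_exp2r // prime_gt1.
  rewrite mul1n; apply: (@leq_trans ((2 ^ e) ^ k)).
    by rewrite leq_exp2r // ltn_expl.
  rewrite expnAC; case: e => [|e]; rewrite ?expn0 // leq_exp2r //.
rewrite big_split /= -(prod_prime_decomp n0) leq_mul2r; apply/orP; right.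
rewrite -(big_map fst predT c) -/(primes n).
rewrite (bigID (fun q => q < 2 ^ k)%N) /= [X in (_ * X)%N]big1 ?muln1; last first.
  by move=> q /negbTE q2; rewrite /c q2.
rewrite (eq_bigr (fun=> k ^ k)%N); last by move=> q q2; rewrite /c q2.
rewrite big_const_seq iter_muln_1 leq_pexp2l //.
rewrite -size_filter -[leqRHS](size_iota 0); apply: uniq_leq_size.
  by rewrite filter_uniq // primes_uniq.
by move=> q; rewrite mem_filter mem_iota => /andP[].
Qed.

(** * The Cauchy-Schwarz inequality *)

(** This form, with s i ^+ 2 <= a i * b i instead of a product of two functions,
spares the square roots of a and b. *)
Lemma sqr_sum_le (R : realDomainType) (I : finType) (s a b : I -> R) :
  (forall i, 0 <= a i) -> (forall i, 0 <= b i) ->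
  (forall i, s i ^+ 2 <= a i * b i) ->
  (\sum_i s i) ^+ 2 <= (\sum_i a i) * (\sum_i b i).
Proof.
move=> a0 b0 sab.
have pair i j : (s i * s j) *+ 2 <= a i * b j + a j * b i.
  apply: le_trans (ler_norm _) _.
  rewrite -(@ler_pXn2r _ 2) ?nnegrE //; last first.
    by rewrite addr_ge0 ?mulr_ge0.
  rewrite real_normK ?num_real //.
  have sij := ler_pM (sqr_ge0 _) (sqr_ge0 _) (sab i) (sab j).
  (* 4 (a i b i)(a j b j) <= (a i b j + a j b i)^2 *)
  have := sqr_ge0 (a i * b j - a j * b i).
  move: sij; set x := s i; set y := s j.
  nra.
rewrite expr2 !big_distrlr /= -(ler_pMn2r (n := 2)) //.
have -> : (\sum_i \sum_j a i * b j) *+ 2 =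
    \sum_i \sum_j (a i * b j + a j * b i).
  rewrite mulr2n; under [RHS]eq_bigr do rewrite big_split.
  by rewrite big_split /=; congr (_ + _); rewrite exchange_big.
rewrite -sumrMnl; apply: ler_sum => i _; rewrite -sumrMnl.
by apply: ler_sum => j _; exact: pair.
Qed.

(** * Reduced fractions lying in a subgroup modulo p *)

Lemma leq_card_fibers (T U : finType) (f : T -> U) (A : {set T}) (B : {set U})
    (n : nat) :
  {in A, forall x, f x \in B} ->
  (forall y, y \in B -> #|[set x in A | f x == y]| <= n)%N ->
  (#|A| <= n * #|B|)%N.
Proof.
move=> fAB fib; rewrite -sum1_card (partition_big f (mem B)) //=.
rewrite mulnC -sum_nat_const; apply: leq_sum => y /fib; apply: leq_trans.
rewrite -sum1_card leq_eqVlt; apply/orP; left; apply/eqP/eq_bigl => x.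
by rewrite inE.
Qed.

Lemma card_dvdn_ord (p n : nat) : (0 < n)%N ->
  (#|[set d : 'I_p | d %| n]| <= tau n)%N.
Proof.
move=> n0; rewrite cardE -(size_map val); apply: uniq_leq_size.
  by rewrite map_inj_uniq ?enum_uniq //; exact: val_inj.
by move=> _ /mapP[d + ->]; rewrite mem_enum inE -dvdn_divisors.
Qed.

Section Fractions.
Variables (p : nat) (G : {group {unit 'F_p}}).
Hypothesis p_prime : prime p.

Definition ratio_in (u v : nat) : bool :=
  [exists l in G, u%:R == v%:R * FinRing.uval l :> 'F_p].

(** Numerators and denominators live in 'I_p because all heights that occur are
smaller than p; they are then nonzero modulo p. *)
Definition fractions (M : nat) : {set 'I_p * 'I_p} :=
  [set z : 'I_p * 'I_p |
    [&& (0 < z.1 <= M)%N, (0 < z.2 <= M)%N, coprime z.1 z.2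
      & ratio_in z.1 z.2]].

Lemma natr_Fp_eq0 n : (n%:R == 0 :> 'F_p) = (p %| n)%N.
Proof. by rewrite (dvdn_pcharf (pchar_Fp p_prime)). Qed.

Lemma natr_Fp_neq0 n : (0 < n)%N -> (n < p)%N -> n%:R != 0 :> 'F_p.
Proof. by move=> n0 np; rewrite natr_Fp_eq0 gtnNdvd. Qed.

Lemma ratio_inM a b c d :
  ratio_in a b -> ratio_in c d -> ratio_in (a * c) (b * d).
Proof.
case/exists_inP => l lG /eqP ab /exists_inP[m mG /eqP cd].
apply/exists_inP; exists (l * m)%g; first by rewrite groupM.
by rewrite !natrM ab cd /= mulrACA.
Qed.

Lemma ratio_in_cancel k u v : (0 < k)%N -> (k < p)%N ->
  ratio_in (k * u) (k * v) -> ratio_in u v.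
Proof.
move=> k0 kp /exists_inP[l lG /eqP e]; apply/exists_inP; exists l => //.
apply/eqP/(mulfI (natr_Fp_neq0 k0 kp)).
by rewrite mulrA -!natrM.
Qed.

(** In the product of the reduced fractions a / b and c / d, the only
cancellations are those between a and d and between c and b. *)
Lemma coprime_cancel a b c d (g := gcdn a d) (h := gcdn c b) :
  (0 < a)%N -> (0 < b)%N -> (0 < c)%N -> (0 < d)%N ->
  coprime a b -> coprime c d ->
  exists u v, [/\ a * c = g * h * u, b * d = g * h * v & coprime u v]%N.
Proof.
move=> a0 b0 c0 d0 cab ccd.
have g0 : (0 < g)%N by rewrite gcdn_gt0 a0.
have h0 : (0 < h)%N by rewrite gcdn_gt0 c0.
have [ga gd] : (g %| a)%N /\ (g %| d)%N by rewrite dvdn_gcdl dvdn_gcdr.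
have [hc hb] : (h %| c)%N /\ (h %| b)%N by rewrite dvdn_gcdl dvdn_gcdr.
have cop x y : (0 < x)%N -> coprime (x %/ gcdn x y) (y %/ gcdn x y).
  move=> x0; have e0 : (0 < gcdn x y)%N by rewrite gcdn_gt0 x0.
  rewrite /coprime -(eqn_pmul2l e0) muln1 muln_gcdr.
  by rewrite ![(gcdn x y * (_ %/ _))%N]mulnC !divnK ?dvdn_gcdl ?dvdn_gcdr.
exists ((a %/ g) * (c %/ h))%N, ((b %/ h) * (d %/ g))%N; split.
- by rewrite mulnACA ![(_ * (_ %/ _))%N]mulnC !divnK.
- rewrite [(b %/ h * _)%N]mulnC mulnACA ![(_ * (_ %/ _))%N]mulnC.
  by rewrite !divnK // mulnC.
- rewrite coprimeMl !coprimeMr; apply/andP; split; apply/andP; split.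
  + exact: coprime_dvdl (dvdn_div ga) (coprime_dvdr (dvdn_div hb) cab).
  + exact: cop.
  + exact: cop.
  + exact: coprime_dvdl (dvdn_div hc) (coprime_dvdr (dvdn_div gd) ccd).
Qed.

Variable D : nat.
Hypothesis tau_le : forall n, (0 < n)%N -> (n < p)%N -> (tau n <= D)%N.

Lemma card_dvd_pairs (m n : nat) :
  (0 < m)%N -> (m < p)%N -> (0 < n)%N -> (n < p)%N ->
  (#|finset.setX [set d : 'I_p | d %| m] [set d : 'I_p | d %| n]| <= D ^ 2)%N.
Proof.
move=> m0 mp n0 np; rewrite cardsX expnS expn1; apply: leq_mul.
  by apply: leq_trans (card_dvdn_ord p m0) (tau_le m0 mp).
by apply: leq_trans (card_dvdn_ord p n0) (tau_le n0 np).
Qed.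

Section Product.
Variables K L : nat.
Hypothesis KLp : (K * L < p)%N.

Local Notation A := (fractions K).
Local Notation B := (fractions L).

(** The two amounts of cancellation in the product of q.1 and q.2.  They are
smaller than p when numerators are positive, so the default value of [insubd]
never shows up ([cross_gcdE]). *)
Definition cross_gcd (q : ('I_p * 'I_p) * ('I_p * 'I_p)) : 'I_p * 'I_p :=
  (insubd q.1.1 (gcdn q.1.1 q.2.2), insubd q.2.1 (gcdn q.2.1 q.1.2)).

Lemma cross_gcdE a b c d : (0 < val a)%N -> (0 < val c)%N ->
  (val (cross_gcd ((a, b), (c, d))).1 = gcdn a d) *
  (val (cross_gcd ((a, b), (c, d))).2 = gcdn c b).
Proof.
move=> a0 c0; split; rewrite val_insubd /=.
  by rewrite (leq_ltn_trans _ (ltn_ord a)) // dvdn_leq // dvdn_gcdl.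
by rewrite (leq_ltn_trans _ (ltn_ord c)) // dvdn_leq // dvdn_gcdl.
Qed.

Definition pairs_with (w : 'I_p * 'I_p) :=
  [set q in finset.setX A B | cross_gcd q == w].

Definition cancelled_product (w : 'I_p * 'I_p)
    (q : ('I_p * 'I_p) * ('I_p * 'I_p)) : 'I_p * 'I_p :=
  (insubd q.1.1 ((q.1.1 * q.2.1) %/ (w.1 * w.2))%N,
   insubd q.1.1 ((q.1.2 * q.2.2) %/ (w.1 * w.2))%N).

Arguments cancelled_product : simpl never.

(** Once the cancellations w are prescribed, the product u / v of a / b and c / d
determines a c and b d, and then a and b are divisors of known numbers below p. *)
Lemma card_pairs_with_le_prod w :
  (#|pairs_with w| <= D ^ 2 * #|fractions (K * L)|)%N.
Proof.
set f := cancelled_product w.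
have key a b c d : ((a, b), (c, d)) \in pairs_with w ->
    [/\ (a * c = w.1 * w.2 * (f ((a, b), (c, d))).1)%N,
        (b * d = w.1 * w.2 * (f ((a, b), (c, d))).2)%N,
        (0 < a * c <= K * L)%N,
        (0 < b * d <= K * L)%N &
        f ((a, b), (c, d)) \in fractions (K * L)].
  move=> qw; rewrite !inE /= in qw; case/andP: qw => /andP[].
  case/and4P => /andP[a0 aK] /andP[b0 bK] cab rab.
  case/and4P => /andP[c0 cL] /andP[d0 dL] ccd rcd /eqP wE.
  have [w1 w2] := cross_gcdE b d a0 c0; rewrite wE in w1 w2.
  have ac0 : (0 < a * c <= K * L)%N by rewrite muln_gt0 a0 c0 leq_mul.
  have bd0 : (0 < b * d <= K * L)%N by rewrite muln_gt0 b0 d0 leq_mul.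
  have [u [v [acE bdE cuv]]] := coprime_cancel a0 b0 c0 d0 cab ccd.
  rewrite -w1 -w2 in acE bdE.
  have gh0 : (0 < w.1 * w.2)%N.
    by move: ac0; rewrite acE; case: (w.1 * w.2)%N.
  have uac : (u <= a * c)%N by rewrite acE leq_pmull.
  have vbd : (v <= b * d)%N by rewrite bdE leq_pmull.
  have uKL : (u <= K * L)%N by apply: leq_trans uac _; case/andP: ac0.
  have vKL : (v <= K * L)%N by apply: leq_trans vbd _; case/andP: bd0.
  have f1 : val (f ((a, b), (c, d))).1 = u.
    rewrite val_insubd /= acE mulKn // (leq_ltn_trans uKL) //.
  have f2 : val (f ((a, b), (c, d))).2 = v.
    rewrite val_insubd /= bdE mulKn // (leq_ltn_trans vKL) //.
  have u0 : (0 < u)%N by move: ac0; rewrite acE; case: (u); rewrite ?muln0.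
  have v0 : (0 < v)%N by move: bd0; rewrite bdE; case: (v); rewrite ?muln0.
  move: (f _) f1 f2 => F.
  rewrite -[val F.1]/(nat_of_ord _) -[val F.2]/(nat_of_ord _) => f1 f2.
  split => //; rewrite ?f1 ?f2 //.
  rewrite inE f1 f2 u0 uKL v0 vKL cuv /=.
  apply: (@ratio_in_cancel (w.1 * w.2)) => //.
    apply: leq_ltn_trans KLp; apply: leq_trans (leq_pmulr _ u0) _.
    by rewrite -acE; case/andP: ac0.
  by rewrite -acE -bdE; exact: ratio_inM.
apply: (leq_card_fibers (f := f)).
  by move=> [[a b] [c d]] /key[].
move=> z zZ.
have [->|[q0 q0F]] := set_0Vmem [set x in pairs_with w | f x == z].
  by rewrite cards0.
have [m [n [m0 mp n0 np mnP]]] : exists m n,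
    [/\ (0 < m)%N, (m < p)%N, (0 < n)%N, (n < p)%N &
     forall a b c d, ((a, b), (c, d)) \in [set x in pairs_with w | f x == z] ->
       (a * c = m)%N /\ (b * d = n)%N].
  exists (w.1 * w.2 * z.1)%N, (w.1 * w.2 * z.2)%N.
  move: q0 q0F => [[a b] [c d]]; rewrite inE => /andP[/key[e1 e2 i1 i2 _] /eqP fz].
  rewrite fz in e1 e2; rewrite -e1 -e2.
  case/andP: i1 => -> i1; case/andP: i2 => -> i2; split => //.
  - exact: leq_ltn_trans i1 KLp.
  - exact: leq_ltn_trans i2 KLp.
  - move=> a' b' c' d'; rewrite inE => /andP[/key[e1' e2' _ _ _] /eqP fz'].
    by rewrite fz' in e1' e2'; rewrite e1' e2' e1 e2.
apply: leq_trans (card_dvd_pairs m0 mp n0 np).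
rewrite -(card_in_imset (f := fst)).
  apply: subset_leq_card; apply/fintype.subsetP.
  move=> _ /imsetP[[[a b] [c d]] /mnP[am bn] ->] /=.
  by rewrite !inE /= -am -bn !dvdn_mulr.
move=> [[a b] [c d]] [[a' b'] [c' d']] /mnP[e1 e2] /mnP[e1' e2'] /= [ea eb].
subst a' b'.
have a0 : (0 < a)%N by move: m0; rewrite -e1 muln_gt0 => /andP[].
have b0 : (0 < b)%N by move: n0; rewrite -e2 muln_gt0 => /andP[].
congr (_, (_, _)); apply: val_inj; apply/eqP.
  by rewrite -(eqn_pmul2l a0) /= e1 e1'.
by rewrite -(eqn_pmul2l b0) /= e2 e2'.
Qed.

Definition left_with (w : 'I_p * 'I_p) :=
  [set r in A | (w.1 %| r.1)%N && (w.2 %| r.2)%N].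
Definition right_with (w : 'I_p * 'I_p) :=
  [set s in B | (w.2 %| s.1)%N && (w.1 %| s.2)%N].

(** The first cancellation divides a numerator of A and a denominator of B, the
second one a denominator of A and a numerator of B. *)
Lemma card_pairs_with_le w :
  (#|pairs_with w| <= #|left_with w| * #|right_with w|)%N.
Proof.
rewrite -cardsX; apply: subset_leq_card; apply/fintype.subsetP => -[[a b] [c d]].
rewrite inE finset.in_setX => /andP[/andP[aA cB] /eqP wE].
move: (aA) (cB); rewrite !inE /=.
move=> /and4P[/andP[a0 _] _ _ _] /and4P[/andP[c0 _] _ _ _].
have [w1 w2] := cross_gcdE b d a0 c0; rewrite wE /= in w1 w2.
rewrite inE in aA; rewrite inE in cB.
by rewrite aA cB w1 w2 !dvdn_gcdl !dvdn_gcdr.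
Qed.

Lemma sum_card_with (X : {set 'I_p * 'I_p}) (P : rel ('I_p * 'I_p)) :
  (forall r, r \in X -> #|[set w | P w r]| <= D ^ 2)%N ->
  (\sum_w #|[set r in X | P w r]| <= D ^ 2 * #|X|)%N.
Proof.
move=> PD; rewrite (eq_bigr (fun w => \sum_(r in X) (P w r : nat))); last first.
  move=> w _; rewrite -sum1_card big_mkcond [RHS]big_mkcond.
  by apply: eq_bigr => r _; rewrite inE; case: (r \in X); case: (P w r).
rewrite exchange_big /= mulnC -sum_nat_const; apply: leq_sum => r /PD.
apply: leq_trans; rewrite -sum1_card [leqRHS]big_mkcond leq_sum // => w _.
by rewrite inE; case: (P w r).
Qed.

(** Sort the pairs of A * B by their cancellations w.  The class of w has at most
D^2 |Z| elements, where Z is the set of fractions of height K L, and at most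
|A_w| |B_w|, where A_w and B_w collect the factors compatible with w.  A given
fraction is compatible with at most D^2 values of w, so Cauchy-Schwarz applied
to the geometric mean of the two bounds gives
(|A| |B|)^2 <= D^2 |Z| (D^2 |A|) (D^2 |B|).  Bounding the number of pairs with a
given product would not do: it can be as large as a power of p. *)
Lemma card_fractionsM :
  (#|A| * #|B| <= D ^ 6 * #|fractions (K * L)|)%N.
Proof.
set Z := #|fractions (K * L)|.
have AB : (#|A| * #|B| = \sum_w #|pairs_with w|)%N.
  rewrite -cardsX -sum1_card (partition_big cross_gcd predT) //=.
  apply: eq_bigr => w _; rewrite -sum1_card; apply: eq_bigl => q.
  by rewrite [RHS]inE.
have sA : (\sum_w #|left_with w| <= D ^ 2 * #|A|)%N.
  apply: (@sum_card_with A
    (fun w r : 'I_p * 'I_p => (w.1 %| r.1)%N && (w.2 %| r.2)%N)) => -[a b].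
  rewrite inE /= => /and4P[/andP[a0 _] /andP[b0 _] _ _].
  apply: leq_trans (card_dvd_pairs a0 (ltn_ord a) b0 (ltn_ord b)).
  by apply: subset_leq_card; apply/fintype.subsetP => -[g h]; rewrite !inE.
have sB : (\sum_w #|right_with w| <= D ^ 2 * #|B|)%N.
  apply: (@sum_card_with B
    (fun w r : 'I_p * 'I_p => (w.2 %| r.1)%N && (w.1 %| r.2)%N)) => -[a b].
  rewrite inE /= => /and4P[/andP[a0 _] /andP[b0 _] _ _].
  apply: leq_trans (card_dvd_pairs b0 (ltn_ord b) a0 (ltn_ord a)).
  by apply: subset_leq_card; apply/fintype.subsetP => -[g h]; rewrite !inE /= andbC.
have cs : ((\sum_w #|pairs_with w|) ^ 2 <=
    (D ^ 2 * Z * (\sum_w #|left_with w|)) * (\sum_w #|right_with w|))%N.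
  have := @sqr_sum_le int _ (fun w => #|pairs_with w|%:R)
    (fun w => (D ^ 2 * Z * #|left_with w|)%N%:R) (fun w => #|right_with w|%:R).
  rewrite -!natr_sum -natrX -natrM ler_nat -big_distrr; apply => //.
  move=> w; rewrite -natrX -natrM ler_nat -mulnA expnS expn1.
  by apply: leq_mul; [exact: card_pairs_with_le_prod | exact: card_pairs_with_le].
have [->|AB0] := posnP (#|A| * #|B|)%N; first by [].
rewrite -(leq_pmul2l AB0).
rewrite -AB expnS expn1 in cs; apply: leq_trans cs _.
have -> : (#|A| * #|B| * (D ^ 6 * Z) =
    D ^ 2 * Z * (D ^ 2 * #|A|) * (D ^ 2 * #|B|))%N.
  by ring.
by apply: leq_mul => //; apply: leq_mul.
Qed.

End Product.
End Fractions.

Section Counting.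
Variables (p : nat) (G : {group {unit 'F_p}}).
Hypothesis p_prime : prime p.

Local Notation fractions := (fractions G).
Local Notation ratio_in := (ratio_in G).

Lemma ratio_in_eq u v : (0 < v < p)%N -> ratio_in u v ->
  u%:R / v%:R \in FinRing.uval @: G.
Proof.
case/andP=> v0 vp /exists_inP[l lG /eqP ->].
have vn0 := natr_Fp_neq0 p_prime v0 vp.
by apply/imsetP; exists l; rewrite // mulrAC divff // mul1r.
Qed.

(** Cut the slopes u / v into sectors of width p / M^2.  Inside a sector the cross
product u v' - u' v is less than v v' p / M^2 <= p in absolute value, hence
zero if p divides it. *)
Lemma same_sector_cross_eq M u v u' v' : (0 < v <= M)%N -> (0 < v' <= M)%N ->
  ((M ^ 2 * u) %/ (p * v) = (M ^ 2 * u') %/ (p * v'))%N ->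
  (u * v')%:R = (u' * v)%:R :> 'F_p -> (u * v' = u' * v)%N.
Proof.
have p0 := prime_gt0 p_prime.
wlog le : u v u' v' / (u' * v <= u * v')%N.
  move=> th v0 v'0 jE e; case/orP: (leq_total (u' * v) (u * v')) => le.
    exact: th.
  by apply/esym; apply: th.
case/andP=> v0 vM /andP[v'0 v'M] jE e.
have d0 : (p %| u * v' - u' * v)%N.
  by rewrite -(natr_Fp_eq0 p_prime) natrB // e subrr.
suff lt : (u * v' - u' * v < p)%N.
  apply/eqP; rewrite eqn_leq le andbT -subn_eq0 -leqn0 leqNgt.
  by apply: contraL d0 => pos; rewrite gtnNdvd.
have M0 : (0 < M)%N by apply: leq_trans vM.
set j := ((M ^ 2 * u) %/ (p * v))%N in jE.
have h1 : (M ^ 2 * u < j.+1 * (p * v))%N by rewrite ltn_ceil // muln_gt0 p0.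
have h2 : (j * (p * v') <= M ^ 2 * u')%N by rewrite jE leq_trunc_div.
have vv : (v * v' <= M ^ 2)%N by rewrite expnS expn1 leq_mul.
have h3 : (M ^ 2 * u * v' < j.+1 * (p * v) * v')%N by rewrite ltn_pmul2r.
have h4 : (j * (p * v') * v <= M ^ 2 * u' * v)%N by rewrite leq_mul2r h2 orbT.
have h5 : (p * (v * v') <= p * M ^ 2)%N by rewrite leq_mul2l vv orbT.
have M20 : (0 < M ^ 2)%N by rewrite expn_gt0 M0.
rewrite -(ltn_pmul2l M20) mulnBr ltn_subLR; last by rewrite leq_mul2l le orbT.
have e1 : (j.+1 * (p * v) * v' = j * (p * v') * v + p * (v * v'))%N by ring.
rewrite e1 in h3; rewrite mulnA; apply: leq_trans h3 _.
rewrite [(M ^ 2 * p)%N]mulnC [(M ^ 2 * (u' * v))%N]mulnA. apply: leq_add => //.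
Qed.

Lemma coprime_cross_eq u v u' v' : coprime u v -> coprime u' v' ->
  (u * v' = u' * v)%N -> u = u' /\ v = v'.
Proof.
move=> c c' e; split; apply/eqP; rewrite eqn_dvd; apply/andP; split.
- by rewrite -(Gauss_dvdl _ c) -e dvdn_mulr.
- by rewrite -(Gauss_dvdl _ c') e dvdn_mulr.
- by rewrite -(@Gauss_dvdr _ u) ?e ?dvdn_mull // coprime_sym.
- by rewrite -(@Gauss_dvdr _ u') -?e ?dvdn_mull // coprime_sym.
Qed.

(** A reduced fraction u / v is determined by its residue in G, by whether u <= v,
and by the sector of its slope u / v or v / u, whichever is at most 1. *)
Lemma card_fractions_le M :
  (#|fractions M| <= 2 * (M ^ 2 %/ p).+1 * #|G|)%N.
Proof.
have p0 := prime_gt0 p_prime.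
pose f (z : 'I_p * 'I_p) : 'F_p * (bool * 'I_(M ^ 2 %/ p).+1) :=
  (z.1%:R / z.2%:R, ((z.1 <= z.2)%N,
     if (z.1 <= z.2)%N then inord ((M ^ 2 * z.1) %/ (p * z.2))
     else inord ((M ^ 2 * z.2) %/ (p * z.1)))).
have sec u v : (0 < v)%N -> (u <= v)%N ->
    ((M ^ 2 * u) %/ (p * v) < (M ^ 2 %/ p).+1)%N.
  move=> v0 uv; rewrite ltnS -[leqRHS](divnMr (p := v)) //; apply: leq_div2r.
  by rewrite leq_mul2l uv orbT.
have finj : {in fractions M &, injective f}.
  move=> [a b] [c d]; rewrite !inE /=.
  case/and4P => /andP[a0 aK] /andP[b0 bK] cab rab.
  case/and4P => /andP[c0 cK] /andP[d0 dK] ccd rcd.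
  have bn0 := natr_Fp_neq0 p_prime b0 (ltn_ord b).
  have dn0 := natr_Fp_neq0 p_prime d0 (ltn_ord d).
  move=> fE; have /eqP := congr1 fst fE.
  rewrite /f /= eqr_div // -!natrM => /eqP e.
  have /= le_eq := congr1 (fun t => t.2.1) fE.
  suff adcb : (a * d = c * b)%N.
    by have [] := coprime_cross_eq cab ccd adcb; move=> /val_inj -> /val_inj ->.
  have /= := congr1 (fun t => t.2.2) fE.
  rewrite -le_eq; case: ifP => ab.
    rewrite ab in le_eq.
    move/(congr1 (@nat_of_ord _)); rewrite /= !inordK ?sec // => jE.
    by apply: same_sector_cross_eq jE e; rewrite ?b0 ?d0.
  rewrite ab in le_eq; have ba : (b <= a)%N by apply: ltnW; rewrite ltnNge ab.
  have dc : (d <= c)%N by apply: ltnW; rewrite ltnNge -le_eq.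
  move/(congr1 (@nat_of_ord _)); rewrite /= !inordK ?sec // => jE.
  rewrite mulnC [RHS]mulnC; apply/esym.
  apply: (same_sector_cross_eq _ _ jE); rewrite ?a0 ?c0 //.
  by rewrite mulnC -e mulnC.
rewrite -(card_in_imset finj).
have -> : (2 * (M ^ 2 %/ p).+1 * #|G| =
  #|finset.setX (FinRing.uval @: G) [set: bool * 'I_(M ^ 2 %/ p).+1]|)%N.
  rewrite cardsX cardsT card_prod card_bool card_ord mulnC; congr (_ * _)%N.
  by apply/esym/card_imset; exact: val_inj.
apply: subset_leq_card; apply/fintype.subsetP => _ /imsetP[[a b] + ->].
rewrite inE /= => /and4P[_ /andP[b0 _] _ rab].
by rewrite finset.in_setX finset.in_setT andbT /= ratio_in_eq // b0 ltn_ord.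
Qed.

(** * Pairs of integers whose ratio lies in the subgroup *)

Definition ratio_pairs (H : nat) : {set 'I_p * 'I_p} :=
  [set z : 'I_p * 'I_p |
    [&& (0 < z.1 <= H)%N, (0 < z.2 <= H)%N & ratio_in z.1 z.2]].

(** Pairs with greatest common divisor g reduce to fractions of height H / g. *)
Lemma card_ratio_pairs_le_sum H :
  (#|ratio_pairs H| <= \sum_(g < H.+1 | 0 < g) #|fractions (H %/ g)|)%N.
Proof.
pose q (z : 'I_p * 'I_p) : 'I_H.+1 := inord (gcdn z.1 z.2).
have qE a b : (0 < val a <= H)%N -> q (a, b) = gcdn a b :> nat.
  case/andP => a0 aH; rewrite /q inordK // ltnS (leq_trans _ aH) //.
  by rewrite dvdn_leq // dvdn_gcdl.
rewrite -sum1_card (partition_big q (fun g : 'I_H.+1 => 0 < g)%N); last first.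
  move=> [a b]; rewrite inE /= => /and3P[aH _ _].
  by rewrite qE // gcdn_gt0; case/andP: aH => ->.
apply: leq_sum => g g0; rewrite sum1_card.
pose f (z : 'I_p * 'I_p) : 'I_p * 'I_p :=
  (insubd z.1 (z.1 %/ g)%N, insubd z.2 (z.2 %/ g)%N).
have f1 z : (f z).1 = (z.1 %/ g)%N :> nat.
  by have := val_insubd z.1 (z.1 %/ g)%N; rewrite (leq_ltn_trans (leq_div _ _)).
have f2 z : (f z).2 = (z.2 %/ g)%N :> nat.
  by have := val_insubd z.2 (z.2 %/ g)%N; rewrite (leq_ltn_trans (leq_div _ _)).
have D z : (z \in ratio_pairs H) && (q z == g) ->
    [/\ (0 < z.1 <= H)%N, (0 < z.2 <= H)%N, ratio_in z.1 z.2 & gcdn z.1 z.2 = g].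
  case: z => a b; rewrite inE /= => /andP[/and3P[aH bH rab] /eqP <-].
  by split; rewrite ?qE.
rewrite -(card_in_imset (f := f)).
  apply: subset_leq_card; apply/fintype.subsetP.
  move=> _ /imsetP[z /D[zH1 zH2 rz gz] ->].
  have [d1 d2] : (g %| z.1)%N /\ (g %| z.2)%N by rewrite -gz dvdn_gcdl dvdn_gcdr.
  case/andP: zH1 => z10 z1H; case/andP: zH2 => z20 z2H.
  have gp : (g < p)%N by apply: leq_ltn_trans (ltn_ord z.1); rewrite dvdn_leq.
  rewrite inE f1 f2; apply/and4P; split.
  - by rewrite divn_gt0 // dvdn_leq //=; apply: leq_div2r.
  - by rewrite divn_gt0 // dvdn_leq //=; apply: leq_div2r.
  - rewrite /coprime -(eqn_pmul2l g0) muln1 muln_gcdr.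
    by rewrite ![(g * (_ %/ _))%N]mulnC !divnK // gz.
  - apply: (ratio_in_cancel p_prime g0 gp).
    by rewrite ![(g * (_ %/ _))%N]mulnC !divnK.
move=> z z' /D[_ _ _ gz] /D[_ _ _ gz'] fzz.
have [d1 d2] : (g %| z.1)%N /\ (g %| z.2)%N by rewrite -gz dvdn_gcdl dvdn_gcdr.
have [d1' d2'] : (g %| z'.1)%N /\ (g %| z'.2)%N.
  by rewrite -gz' dvdn_gcdl dvdn_gcdr.
have e1 := f1 z; have e2 := f2 z; rewrite fzz f1 in e1; rewrite fzz f2 in e2.
rewrite [z]surjective_pairing [z']surjective_pairing.
congr (_, _); apply: val_inj => /=.
  by rewrite -(divnK d1) -(divnK d1') e1.
by rewrite -(divnK d2) -(divnK d2') e2.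
Qed.

(** H / g counts the multiples of g up to H, so the sum counts the divisors of all
the integers up to H. *)
Lemma sum_floor_le H D : (forall n, (0 < n <= H)%N -> (tau n <= D)%N) ->
  (\sum_(g < H.+1 | 0 < g) H %/ g <= H * D)%N.
Proof.
move=> tD; under eq_bigr do rewrite divn_count_dvd.
rewrite exchange_big /=.
apply: (@leq_trans (\sum_(1 <= i < H.+1) D)); last first.
  by rewrite sum_nat_const_nat subSS subn0.
rewrite big_nat_cond [leqRHS]big_nat_cond; apply: leq_sum => i.
rewrite andbT ltnS => iH; apply: leq_trans (tD i iH).
apply: leq_trans (card_dvdn_ord H.+1 _); last by case/andP: iH.
rewrite -sum1_card big_mkcond [leqRHS]big_mkcond; apply: leq_sum => g _.
by rewrite inE; case: ifP => // _; case: (g %| i)%N.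
Qed.

Lemma card_ratio_pairs_le (R : realDomainType) (B : R) H D : 0 <= B ->
  (forall n, (0 < n <= H)%N -> (tau n <= D)%N) ->
  (forall K, (0 < K <= H)%N -> #|fractions K|%:R <= B * K%:R) ->
  #|ratio_pairs H|%:R <= B * (H * D)%:R.
Proof.
move=> B0 tD fB.
apply: (@le_trans _ _ (B * (\sum_(g < H.+1 | (0 < g)%N) H %/ g)%N%:R)); last first.
  by rewrite ler_wpM2l // ler_nat sum_floor_le.
apply: (@le_trans _ _ (\sum_(g < H.+1 | (0 < g)%N) #|fractions (H %/ g)|%:R)).
  by rewrite -natr_sum ler_nat card_ratio_pairs_le_sum.
rewrite natr_sum mulr_sumr; apply: ler_sum => g g0; apply: fB.
by rewrite divn_gt0 // -ltnS ltn_ord leq_div.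
Qed.

End Counting.

(** * Character sums over an interval and a subgroup *)

Lemma sum_nat_ord (V : nmodType) (p H : nat) (F : nat -> V) : (H < p)%N ->
  \sum_(1 <= x < H.+1) F x = \sum_(x < p | (0 < x <= H)%N) F x.
Proof.
move=> Hp; rewrite (big_nat_widenl _ 0) // (big_nat_widen _ _ p) // big_mkord.
by apply: eq_bigl => x; rewrite ltnS.
Qed.

Section Characters.
Variables (R : realType) (p : nat) (chi : 'F_p -> R[i]).
Hypothesis p_prime : prime p.
Hypothesis chiP : mult_char chi.
Hypothesis chi_nonprincipal : chi <> @principal_char R p.

Let chi0 : chi 0 = 0. Proof. by case: chiP. Qed.
Let chi1 : chi 1 = 1. Proof. by case: chiP. Qed.
Let chiM : {morph chi : x y / x * y}. Proof. by case: chiP. Qed.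

Lemma norm_char x : x != 0 -> `|chi x| = 1.
Proof.
move=> x0; have chix0 : chi x != 0.
  apply: contra_neq (oner_neq0 R[i]) => cx0.
  by rewrite -chi1 -(divff x0) chiM cx0 mul0r.
have chiX n : chi (x ^+ n) = chi x ^+ n.
  by elim: n => [|n IHn]; rewrite ?expr0 // !exprS chiM IHn.
have xp : x ^+ p = x by have := finfield.expf_card x; rewrite card_Fp.
have := chiX p; rewrite xp -[in X in _ = X -> _](prednK (prime_gt0 p_prime)).
rewrite exprS -{1}[chi x]mulr1.
move/(mulfI chix0)/(congr1 (fun z => `|z|)); rewrite normrX normr1 => /esym/eqP.
have p1 : (0 < p.-1)%N by rewrite -ltnS (prednK (prime_gt0 p_prime)) prime_gt1.
by rewrite (pexpr_eq1 p1) // => /eqP.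
Qed.

Lemma sum_char : \sum_x chi x = 0.
Proof.
have [y [y0 chiy]] : exists y, y != 0 /\ chi y != 1.
  apply/not_existsP => all1; apply: chi_nonprincipal; apply/funext => x.
  rewrite /principal_char; case: eqVneq => [-> //|x0].
  by have := all1 x; rewrite x0 => /not_andP[//|/negP/negPn/eqP].
have : \sum_x chi x = chi y * \sum_x chi x.
  rewrite mulr_sumr (reindex_inj (mulfI y0)) /=.
  by apply: eq_bigr => x _; rewrite chiM.
move/eqP; rewrite -subr_eq0 -{1}[\sum_x _]mul1r -mulrBl mulf_eq0 subr_eq0.
by rewrite eq_sym (negbTE chiy) => /eqP.
Qed.

Lemma conj_char x : ((chi x)^*)%R = chi x^-1.
Proof.
have [->|x0] := eqVneq x 0; first by rewrite invr0 chi0 conjC0.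
have chix0 : chi x != 0 by rewrite -normr_eq0 norm_char ?oner_eq0.
apply: (mulfI chix0); rewrite -normCK norm_char // expr1n -chiM divff //.
Qed.

(** Translating, this is the sum of chi((v + d) / v) = chi(1 + d / v) over v != 0
with d = b - c != 0; then 1 + d / v runs over all residues but 1. *)
Lemma char_correlation b c : b != c ->
  \sum_u chi (u + b) * ((chi (u + c))^*)%R = -1.
Proof.
move=> bc; have d0 : b - c != 0 by rewrite subr_eq0.
rewrite (reindex_inj (addIr (- c))) /=.
rewrite (reindex_inj (@invr_inj _)) (reindex_inj (mulIf (invr_neq0 d0))) /=.
rewrite (bigD1 0) //= mul0r invr0 !add0r addNr chi0 conjC0 mulr0 add0r.
have -> : \sum_(u | u != 0) chi ((u / (b - c))^-1 - c + b) *
      ((chi ((u / (b - c))^-1 - c + c))^*)%R = \sum_(u | u != 0) chi (1 + u).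
  apply: eq_bigr => u u0; rewrite subrK conj_char -chiM invrK; congr (chi _).
  rewrite -addrA [- c + b]addrC mulrDl mulVf ?mulf_neq0 ?invr_neq0 //.
  by rewrite mulrCA divff // mulr1.
have := sum_char; rewrite (reindex_inj (addrI 1)) /= (bigD1 0) //= addr0 chi1.
by move/eqP; rewrite addrC addr_eq0 => /eqP.
Qed.

Variables (G : {group {unit 'F_p}}) (a : 'F_p).
Hypothesis a0 : a != 0.

Definition shifted_sum (u : 'F_p) : R[i] :=
  \sum_(l in G) chi (u + a * FinRing.uval l).

(** Expanding the square, the off-diagonal correlations are all negative. *)
Lemma second_moment :
  \sum_u `|shifted_sum u| ^+ 2 <= (p * #|G|)%:R.
Proof.
have -> : \sum_u `|shifted_sum u| ^+ 2 = \sum_(l in G) \sum_(m in G)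
    \sum_u chi (u + a * FinRing.uval l) * ((chi (u + a * FinRing.uval m))^*)%R.
  under [RHS]eq_bigr do rewrite exchange_big /=.
  rewrite [RHS]exchange_big /=; apply: eq_bigr => u _.
  by rewrite normCK /shifted_sum rmorph_sum big_distrlr.
apply: (@le_trans _ _ (\sum_(l in G) p%:R)); last first.
  by rewrite sumr_const natrM mulr_natr.
apply: ler_sum => l lG; rewrite (bigD1 l) //=.
rewrite -[leRHS]addr0; apply: lerD.
  apply: (@le_trans _ _ (\sum_(u : 'F_p) 1)); last first.
    by rewrite sumr_const card_Fp.
  apply: ler_sum => u _; rewrite -normCK.
  have [->|u0] := eqVneq (u + a * FinRing.uval l) 0.
    by rewrite chi0 normr0 expr0n ler01.
  by rewrite norm_char // expr1n.
apply: sumr_le0 => m /andP[mG ml]; rewrite char_correlation ?oppr_le0 ?ler01 //.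
apply: contra_neq ml => /(mulfI a0) /val_inj ->; done.
Qed.

Lemma norm_shifted_sumM u m : m \in G ->
  `|shifted_sum (u * FinRing.uval m)| = `|shifted_sum u|.
Proof.
move=> mG; have -> : shifted_sum (u * FinRing.uval m) =
    chi (FinRing.uval m) * shifted_sum u.
  rewrite /shifted_sum mulr_sumr (reindex_inj (mulIg m)) /=.
  rewrite (eq_bigl [in G]); last by move=> l; rewrite /= groupMr.
  apply: eq_bigr => l lG; rewrite -chiM /=; congr (chi _).
  by ring.
rewrite normrM norm_char ?mul1r //.
by have := valP m; rewrite unitfE.
Qed.

Variable H : nat.
Hypothesis Hp : (H < p)%N.

Local Notation P :=
  [set z : 'I_p * {unit 'F_p} | (0 < z.1 <= H)%N && (z.2 \in G)].
Local Notation prod_of :=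
  (fun z : 'I_p * {unit 'F_p} => z.1%:R * FinRing.uval z.2 : 'F_p).
Local Notation nu u := #|[set z in P | prod_of z == u]|.
Local Notation phi u := (complex.Re `|shifted_sum u|).

(** The left side counts the solutions of x m = y l with x, y <= H and m, l in G:
such a solution has x / y in G, and x, y and m determine l. *)
Lemma sum_nu_sq_le :
  (\sum_u nu u ^ 2 <= #|G| * #|ratio_pairs G H|)%N.
Proof.
have -> : (\sum_u nu u ^ 2 = \sum_(z in P) nu (prod_of z))%N.
  rewrite [RHS](partition_big prod_of predT) //=; apply: eq_bigr => u _.
  rewrite (eq_bigr (fun=> nu u)); last by move=> z /andP[_ /eqP ->].
  rewrite sum_nat_const expnS expn1; congr (_ * _)%N.
  by apply: eq_card => z; rewrite inE.
apply: (@leq_trans (\sum_(z in P)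
    #|[set y : 'I_p | (0 < y <= H)%N && ratio_in G z.1 y]|)).
  apply: leq_sum => -[x m]; rewrite inE /= => /andP[/andP[x0 xH] mG].
  have x0' := natr_Fp_neq0 p_prime x0 (ltn_ord x).
  rewrite -(card_in_imset (f := fst)).
    apply: subset_leq_card; apply/fintype.subsetP => _ /imsetP[[y l] + ->].
    rewrite !inE /= => /andP[/andP[yH lG] /eqP e]; rewrite yH /=.
    apply/exists_inP; exists (l * m^-1)%g; first by rewrite groupM ?groupV.
    have um : FinRing.uval m \is a GRing.unit := valP m.
    by rewrite /= mulrA e mulrK.
  move=> [y l] [y' l']; rewrite !inE /= => /andP[/andP[/andP[y0 _] _] /eqP e].
  move=> /andP[_ /eqP e'] yy; subst y'; congr (_, _); apply: val_inj.
  by apply: (mulfI (natr_Fp_neq0 p_prime y0 (ltn_ord y))); rewrite /= e e'.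
rewrite [leqLHS](_ : _ = \sum_(x : 'I_p | (0 < x <= H)%N) \sum_(m in G)
    #|[set y : 'I_p | (0 < y <= H)%N && ratio_in G x y]|)%N; last first.
  by rewrite pair_big /=; apply: eq_bigl => z; rewrite inE.
under eq_bigr do rewrite sum_nat_const.
rewrite -big_distrr leq_mul2l; apply/orP; right => /=.
rewrite -[leqRHS]sum1_card.
rewrite [leqRHS](_ : _ = \sum_(x : 'I_p | (0 < x <= H)%N)
   \sum_(y : 'I_p | (0 < y <= H)%N && ratio_in G x y) 1)%N; last first.
  by rewrite pair_big_dep /=; apply: eq_bigl => z; rewrite inE.
apply: leq_sum => x _; rewrite -sum1_card leq_eqVlt; apply/orP; left.
by apply/eqP/eq_bigl => y; rewrite inE.
Qed.

(** Averaging over the products x m, m in G, multiplies the number of points by T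
at no cost, as |Phi| is G-invariant; the T N coincidences among them are few
enough for Cauchy-Schwarz to be efficient. *)
Lemma char_sum_sq_le :
  (complex.Re `| \sum_(1 <= x < H.+1) \sum_(l in G)
     chi (x%:R + a * FinRing.uval l) |) ^+ 2
  <= (p * #|ratio_pairs G H|)%:R.
Proof.
set S := \sum_(1 <= x < H.+1) _.
have normE (z : R[i]) : `|z| = (complex.Re `|z|)%:C.
  by rewrite RRe_real // normr_real.
have phi_ge0 u : 0 <= phi u by rewrite -lecR -normE normr_ge0.
have T0 : 0 < #|G|%:R :> R by rewrite ltr0n cardG_gt0.
have Sphi : #|G|%:R * complex.Re `|S| <= \sum_u (nu u)%:R * phi u.
  have -> : \sum_u (nu u)%:R * phi u =
      #|G|%:R * \sum_(x < p | (0 < x <= H)%N) phi x%:R.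
    transitivity (\sum_(z in P) phi (prod_of z)).
      rewrite [RHS](partition_big prod_of predT) //=; apply: eq_bigr => u _.
      rewrite (eq_bigr (fun=> phi u)); last by move=> z /andP[_ /eqP ->].
      rewrite sumr_const mulr_natl; congr (_ *+ _).
      by apply: eq_card => z; rewrite inE.
    rewrite mulr_sumr.
    transitivity (\sum_(x < p | (0 < x <= H)%N)
        \sum_(m in G) phi (x%:R * FinRing.uval m)).
      by rewrite pair_big /=; apply: eq_bigl => z; rewrite inE.
    apply: eq_bigr => x _; rewrite (eq_bigr (fun=> phi x%:R)).
      by rewrite sumr_const mulr_natl.
    by move=> m mG; rewrite norm_shifted_sumM.
  rewrite ler_pM2l // -lecR -normE rmorph_sum /=.
  rewrite /S (sum_nat_ord _ Hp); apply: le_trans (ler_norm_sum _ _ _) _.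
  by apply: ler_sum => x _; rewrite -normE.
have cs : (\sum_u (nu u)%:R * phi u) ^+ 2 <=
    (\sum_u (nu u ^ 2)%N%:R) * \sum_u phi u ^+ 2.
  by apply: sqr_sum_le => u; rewrite ?ler0n ?sqr_ge0 // exprMn natrX.
have mom : \sum_u phi u ^+ 2 <= (p * #|G|)%:R.
  rewrite -lecR rmorph_sum /= rmorph_nat; apply: le_trans second_moment.
  by apply: ler_sum => u _; rewrite rmorphXn /= -normE.
rewrite -natr_sum in cs.
have cs2 : (\sum_u (nu u)%:R * phi u) ^+ 2 <=
    (#|G| * #|ratio_pairs G H|)%:R * (p * #|G|)%:R.
  apply: le_trans cs _; apply: ler_pM => //; rewrite ?ler_nat ?sum_nu_sq_le //.
  by apply: sumr_ge0 => u _; exact: sqr_ge0.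
have S0 : 0 <= #|G|%:R * complex.Re `|S|.
  by rewrite mulr_ge0 ?ler0n // -lecR -normE normr_ge0.
have cs3 : (#|G|%:R * complex.Re `|S|) ^+ 2 <=
    (#|G| * #|ratio_pairs G H|)%:R * (p * #|G|)%:R.
  apply: le_trans cs2; rewrite ler_pXn2r // nnegrE //.
  exact: le_trans S0 Sphi.
move: cs3; rewrite exprMn !natrM => cs3.
rewrite -(ler_pM2l (exprn_gt0 2 T0)); apply: le_trans cs3 _.
rewrite le_eqVlt; apply/orP; left; apply/eqP; ring.
Qed.

End Characters.

(** * Counting fractions of a subgroup of order about the square root of p *)

(** In this section y stands for p^(1/24) and x for p^eps', so that heights up to
p^(1/4 + eps') are those up to y^6 x, and 4 <= x absorbs numerical constants. *)
Section PowerSaving.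
Variables (R : realFieldType) (p : nat) (G : {group {unit 'F_p}}) (D : nat).
Hypothesis p_prime : prime p.
Hypothesis tau_le : forall n, (0 < n)%N -> (n < p)%N -> (tau n <= D)%N.
Variables x y : R.
Hypothesis x_ge4 : 4 <= x.
Hypothesis x4_le_y : x ^+ 4 <= y.
Hypothesis pE : p%:R = y ^+ 24.
Hypothesis D_le : D%:R <= x.
Hypothesis T_le : #|G|%:R <= y ^+ 12 * x.

Local Notation r K := (#|fractions G K|%:R : R).

Let x0 : 0 < x. Proof. by apply: lt_le_trans x_ge4. Qed.
Let x1 : 1 <= x. Proof. by apply: le_trans x_ge4; rewrite ler1n. Qed.
Let xX1 n : 1 <= x ^+ n. Proof. exact: exprn_ege1. Qed.
Let y1 : 1 < y.
Proof.
apply: lt_le_trans x4_le_y; rewrite exprn_egt1 //.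
by apply: lt_le_trans x_ge4; rewrite ltr1n.
Qed.
Let y0 : 0 < y. Proof. exact: lt_trans y1. Qed.
Let yX0 n : 0 < y ^+ n. Proof. exact: exprn_gt0. Qed.
Let x_ge0 : 0 <= x. Proof. exact: ltW. Qed.
Let y_ge0 : 0 <= y. Proof. exact: ltW. Qed.
Let y_ge1 : 1 <= y. Proof. exact: ltW. Qed.
Let xX_ge0 n : 0 <= x ^+ n. Proof. exact: exprn_ge0. Qed.
Let yX_ge0 n : 0 <= y ^+ n. Proof. exact: exprn_ge0. Qed.
Let x_gt1 : 1 < x. Proof. by apply: lt_le_trans x_ge4; rewrite ltr1n. Qed.
Let p_gt0 : 0 < p%:R :> R. Proof. by rewrite pE. Qed.

Lemma fractions_le (M : nat) :
  r M <= 2 * (M%:R ^+ 2 / y ^+ 24 + 1) * (y ^+ 12 * x).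
Proof.
apply: (@le_trans _ _ (2 * (M ^ 2 %/ p).+1 * #|G|)%N%:R).
  by rewrite ler_nat card_fractions_le.
rewrite !natrM; apply: ler_pM => //; rewrite ?mulr_ge0 ?ler0n //.
apply: ler_wpM2l; first exact: ler0n.
rewrite -natr1 lerD2r -pE ler_pdivlMr // -natrM -natrX ler_nat.
exact: leq_trunc_div.
Qed.

Lemma fractionsM_le (K L : nat) : K%:R * L%:R < y ^+ 24 ->
  r K * r L <= x ^+ 6 * r (K * L).
Proof.
rewrite -pE -natrM ltr_nat => KLp.
apply: (@le_trans _ _ (D%:R ^+ 6 * r (K * L))).
  by rewrite -natrX -!natrM ler_nat card_fractionsM.
by apply: ler_wpM2r; [exact: ler0n | apply: lerXn2r; rewrite ?nnegrE // ltW].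
Qed.

(** r(K)^2 <= x^6 r(K^2) and r(K^2) is at most about T = y^12, as K^4 is at most
about p.  The resulting bound y^6 is y times y^5 <= K. *)
Lemma fractions_bound_large (K : nat) : y ^+ 5 <= K%:R -> K%:R <= y ^+ 6 * x ->
  r K <= y * x ^+ 6 * K%:R.
Proof.
move=> K5 K6; set k : R := K%:R in K5 K6 *.
have k0 : 0 <= k by exact: ler0n.
have kk : k * k <= (y ^+ 6 * x) ^+ 2.
  by rewrite -expr2 lerXn2r ?nnegrE // (le_trans k0).
have kkp : k * k < y ^+ 24.
  apply: le_lt_trans kk _; apply: (@le_lt_trans _ _ (y ^+ 12 * x ^+ 4)).
    by rewrite exprMn -exprM ler_wpM2l // ler_eXn2l.
  apply: (@le_lt_trans _ _ (y ^+ 12 * y)); first by rewrite ler_wpM2l.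
  by rewrite -exprSr ltr_eXn2l.
have q4 : (k * k) ^+ 2 / y ^+ 24 + 1 <= 2 * x ^+ 4.
  rewrite mulr_natl mulr2n; apply: lerD; last exact: xX1.
  rewrite ler_pdivrMr //; apply: le_trans (_ : ((y ^+ 6 * x) ^+ 2) ^+ 2 <= _).
    by rewrite lerXn2r ?nnegrE ?mulr_ge0 ?exprn_ge0 // mulr_gt0.
  by rewrite le_eqVlt; apply/orP; left; apply/eqP; ring.
have r2 : r K ^+ 2 <= (y ^+ 6 * x ^+ 6) ^+ 2.
  rewrite expr2; apply: le_trans (fractionsM_le kkp) _.
  apply: (@le_trans _ _ (x ^+ 6 * (2 * (2 * x ^+ 4) * (y ^+ 12 * x)))).
    rewrite ler_wpM2l ?exprn_ge0 //; apply: le_trans (fractions_le _) _.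
    rewrite ler_wpM2r ?mulr_ge0 ?exprn_ge0 // ler_wpM2l ?ler0n // natrM.
    exact: q4.
  have -> : x ^+ 6 * (2 * (2 * x ^+ 4) * (y ^+ 12 * x)) =
    4 * (x ^+ 11 * y ^+ 12) by ring.
  have -> : (y ^+ 6 * x ^+ 6) ^+ 2 = x * (x ^+ 11 * y ^+ 12) by ring.
  by rewrite ler_wpM2r // mulr_ge0 ?exprn_ge0.
have r1 : r K <= y ^+ 6 * x ^+ 6.
  by rewrite -(@ler_pXn2r _ 2) // nnegrE ?ler0n // mulr_ge0 ?exprn_ge0.
apply: le_trans r1 _.
have -> : y ^+ 6 * x ^+ 6 = y * x ^+ 6 * y ^+ 5 by ring.
by rewrite ler_wpM2l // mulr_ge0 ?exprn_ge0.
Qed.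

(** r(K)^3 <= x^12 r(K^3), and r(K^3) is at most about T (K^6 / p + 1).  The range
of K is the one where both K^6 / y^24 and 1 are at most K^3 / y^9. *)
Lemma fractions_bound_medium (K : nat) : y ^+ 3 <= K%:R -> K%:R <= y ^+ 5 ->
  r K <= y * x ^+ 6 * K%:R.
Proof.
move=> K3 K5; set k : R := K%:R in K3 K5 *.
have k0 : 0 < k by exact: lt_le_trans K3.
have k1 : 1 <= k by apply: le_trans K3; rewrite exprn_ege1 // ltW.
have kkk : k ^+ 3 <= y ^+ 15.
  by rewrite -[15%N]/(5 * 3)%N exprM lerXn2r ?nnegrE // ltW.
have kkkp : (K * K)%:R * K%:R < y ^+ 24 :> R.
  rewrite natrM -/k -expr2 -exprSr; apply: le_lt_trans kkk _.
  by rewrite ltr_eXn2l.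
have kkp : K%:R * K%:R < y ^+ 24 :> R.
  by apply: le_lt_trans kkkp; rewrite natrM -/k ler_peMr // mulr_ge0 // ltW.
have q4 : (k ^+ 3) ^+ 2 / y ^+ 24 + 1 <= 2 * (k ^+ 3 / y ^+ 9).
  rewrite mulr_natl mulr2n; apply: lerD.
    rewrite ler_pdivrMr //.
    have -> : k ^+ 3 / y ^+ 9 * y ^+ 24 = k ^+ 3 * y ^+ 15.
      by field; rewrite lt0r_neq0.
    by rewrite expr2 ler_pM2l ?exprn_gt0.
  rewrite ler_pdivlMr // mul1r -[9%N]/(3 * 3)%N exprM.
  by rewrite lerXn2r ?nnegrE // ltW.
have r3 : r K ^+ 3 <= (y * x ^+ 6 * k) ^+ 3.
  apply: (@le_trans _ _ (x ^+ 6 * (x ^+ 6 * r (K * K * K)))).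
    apply: (@le_trans _ _ (x ^+ 6 * (r (K * K) * r K))).
      rewrite exprSr expr2 mulrA ler_wpM2r ?ler0n //.
      exact: fractionsM_le.
    rewrite ler_wpM2l ?exprn_ge0 //; exact: fractionsM_le.
  apply: (@le_trans _ _ (x ^+ 6 * (x ^+ 6 *
      (2 * (2 * (k ^+ 3 / y ^+ 9)) * (y ^+ 12 * x))))).
    rewrite !ler_wpM2l ?exprn_ge0 //; apply: le_trans (fractions_le _) _.
    rewrite ler_wpM2r ?mulr_ge0 ?exprn_ge0 // ler_wpM2l ?ler0n //.
    by rewrite !natrM -/k -expr2 -exprSr.
  have -> : x ^+ 6 * (x ^+ 6 *
      (2 * (2 * (k ^+ 3 / y ^+ 9)) * (y ^+ 12 * x))) =
    4 * (x ^+ 13 * (y ^+ 3 * k ^+ 3)) by field; rewrite ?lt0r_neq0.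
  have -> : (y * x ^+ 6 * k) ^+ 3 =
    x ^+ 5 * (x ^+ 13 * (y ^+ 3 * k ^+ 3)) by ring.
  rewrite ler_wpM2r //; first by rewrite !mulr_ge0 ?exprn_ge0.
  by apply: le_trans x_ge4 _; rewrite -[leLHS]expr1 ler_weXn2l.
rewrite -(@ler_pXn2r _ 3) // nnegrE ?ler0n //.
by rewrite !mulr_ge0 ?exprn_ge0.
Qed.

(** The quotient r(K) / K is at most x^3 times the square root of its value at
K^2, so the bound for K^2 implies the one for K. *)
Lemma fractions_bound (K : nat) : (0 < K)%N -> K%:R <= y ^+ 6 * x ->
  r K <= y * x ^+ 6 * K%:R.
Proof.
have [n] := ubnP (p - K); elim: n K => // n IHn K Kn K0 K6.
have [K5|/ltW K5] := leP (y ^+ 5) K%:R; first exact: fractions_bound_large.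
have [K3|K3] := leP (y ^+ 3) K%:R; first exact: fractions_bound_medium.
have k0 : 0 < K%:R :> R by rewrite ltr0n.
have KK6 : K%:R * K%:R < y ^+ 6 :> R.
  by rewrite -[6%N]/(3 + 3)%N exprD ltr_pM // ltW.
have KKp : K%:R * K%:R < y ^+ 24 :> R.
  by apply: lt_trans KK6 _; rewrite ltr_eXn2l.
have xy0 : 0 <= y * x ^+ 6 by rewrite mulr_ge0 ?exprn_ge0.
(* K = 1 is its own square; there the product inequality gives r(1) <= x^6. *)
have [K1|K1] := leqP K 1.
  have KE : K = 1%N by apply/eqP; rewrite eqn_leq K1.
  have := fractionsM_le KKp; rewrite KE muln1 mulr1.
  have [->|rn0] := eqVneq (r 1) 0; first by rewrite mulr0.
  have r0 : 0 < r 1 by rewrite lt_def rn0 ler0n.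
  rewrite ler_pM2r // => /le_trans; apply.
  by rewrite ler_peMl ?exprn_ge0.
have rKK : r (K * K) <= y * x ^+ 6 * (K%:R * K%:R).
  rewrite -natrM; apply: IHn; rewrite ?muln_gt0 ?K0 //; last first.
    by rewrite natrM; apply: le_trans (ltW KK6) _; rewrite ler_peMr // ltW.
  rewrite -ltnS; apply: leq_trans Kn; rewrite ltnS ltn_sub2l //.
    by rewrite -(ltr_nat R) pE; apply: lt_trans K3 _; rewrite ltr_eXn2l.
  by rewrite -[ltnLHS]muln1 ltn_pmul2l.
rewrite -(@ler_pXn2r _ 2) ?nnegrE ?ler0n ?mulr_ge0 ?ler0n // expr2.
apply: le_trans (fractionsM_le KKp) _.
apply: le_trans (_ : x ^+ 6 * (y * x ^+ 6 * (K%:R * K%:R)) <= _).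
  by rewrite ler_wpM2l ?exprn_ge0.
have -> : (y * x ^+ 6 * K%:R) ^+ 2 =
  y * (x ^+ 6 * (y * x ^+ 6 * (K%:R * K%:R))) by ring.
by rewrite ler_peMl ?mulr_ge0 ?exprn_ge0.
Qed.

Lemma ratio_pairs_bound (H : nat) : H%:R <= y ^+ 6 * x ->
  #|ratio_pairs G H|%:R <= y * x ^+ 7 * H%:R.
Proof.
move=> H6.
have Hp : (H < p)%N.
  rewrite -(ltr_nat R) pE; apply: le_lt_trans H6 _.
  apply: (@le_lt_trans _ _ (y ^+ 6 * y)).
    rewrite ler_wpM2l ?exprn_ge0 //; apply: le_trans x4_le_y.
    by rewrite -[leLHS]expr1 ler_weXn2l.
  by rewrite -exprSr ltr_eXn2l.
have xy0 : 0 <= y * x ^+ 6 by rewrite mulr_ge0 ?exprn_ge0.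
apply: (@le_trans _ _ (y * x ^+ 6 * (H * D)%:R)).
  apply: card_ratio_pairs_le => //.
    move=> n /andP[n0 nH]; apply: tau_le => //; exact: leq_ltn_trans Hp.
  move=> K /andP[K0 KH]; apply: fractions_bound => //.
  by apply: le_trans H6; rewrite ler_nat.
have -> : y * x ^+ 7 * H%:R = y * x ^+ 6 * (H%:R * x) by ring.
by rewrite natrM ler_wpM2l // ler_wpM2l // ler0n.
Qed.

End PowerSaving.

(** * The exponent 5/48 *)

Lemma max_tau_le (R : realType) (E : R) (k C p : nat) :
  (0 < k)%N -> 2 <= E * k%:R -> (0 < p)%N -> (C <= p)%N ->
  (forall n, (0 < n)%N -> (tau n ^ k <= C * n)%N) ->
  forall n, (0 < n)%N -> (n < p)%N -> (tau n)%:R <= p%:R `^ E.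
Proof.
move=> k0 kE p0 Cp tC n n0 np.
rewrite -(@ler_pXn2r _ k) // ?nnegrE ?ler0n ?powR_ge0 //.
rewrite -natrX; apply: (@le_trans _ _ (p%:R ^+ 2)).
  rewrite -natrX ler_nat; apply: leq_trans (tC n n0) _.
  by rewrite expnS expn1 leq_mul // ltnW.
rewrite -[leRHS]powR_mulrn ?powR_ge0 // -powRrM -powR_mulrn ?ler0n //.
by apply: ler_powR => //; rewrite ler1n.
Qed.

Theorem theorem3 (R : realType) (eps : R) (heps : 0 < eps) :
  exists (eps' : R) (p0 : nat), 0 < eps' /\
    forall (p H T : nat) (G : {group {unit 'F_p}}) (a : 'F_p)
           (chi : 'F_p -> R[i]),
      prime p -> (p0 <= p)%N ->
      (0 < H)%N ->
      p%:R `^ (1 / 4 - eps') <= H%:R <= p%:R `^ (1 / 4 + eps') ->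
      #|G| = T ->
      p%:R `^ (1 / 2 - eps') <= T%:R <= p%:R `^ (1 / 2 + eps') ->
      a != 0 ->
      mult_char chi -> chi <> @principal_char R p ->
      `| \sum_(1 <= x < H.+1) \sum_(lambda in G)
           chi (x%:R + a * FinRing.uval lambda) |
        <= (H%:R * T%:R * p%:R `^ (- 5 / 48 + eps))%:C.
Proof.
(* The losses add up to x^10 = p^(10 E) in |S|^2, hence eps / 5; the second term
   ensures x^4 <= y.  The exponent k below makes the divisor bound at most p^E. *)
pose E := Num.min (eps / 5) (1 / 100).
have E0 : 0 < E by rewrite lt_min !divr_gt0.
have E5 : 5 * E <= eps.
  have : E <= eps / 5 by rewrite ge_min lexx.
  by rewrite ler_pdivlMr // mulrC.
have E100 : E <= 1 / 100 by rewrite ge_min lexx orbT.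
pose k := (Num.bound (2 / E)).+1.
have kE : 2 <= E * k%:R.
  rewrite mulrC -ler_pdivrMr //; apply: ltW.
  apply: lt_trans (archi_boundP _) _; first by rewrite divr_ge0 // ltW.
  by rewrite ltr_nat.
have [C tC] := divisor_bound (ltn0Sn (Num.bound (2 / E)) : (0 < k)%N).
exists E, (maxn C (Num.bound (4 `^ E^-1 : R))); split=> // p H T G a chi p_prime.
rewrite geq_max => /andP[Cp p4] H0 /andP[HlE HuE] GT /andP[TlE TuE] a0 chiP chiN.
have p0 := prime_gt0 p_prime.
have q1 : 1 <= p%:R :> R by rewrite ler1n.
have qp : 0 < p%:R :> R by rewrite ltr0n.
pose y : R := p%:R `^ (1 / 24); pose x : R := p%:R `^ E.
have y0 : 0 < y by exact: powR_gt0.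
have x0 : 0 < x by exact: powR_gt0.
have qD s t : (p%:R : R) `^ (s + t) = p%:R `^ s * p%:R `^ t.
  by rewrite powRD // (gt_eqF qp) implybT.
have yX n : y ^+ n = p%:R `^ (n%:R / 24).
  by rewrite -powR_mulrn ?powR_ge0 // -powRrM; congr (_ `^ _); field.
have xX n : x ^+ n = p%:R `^ (n%:R * E).
  by rewrite -powR_mulrn ?powR_ge0 // -powRrM; congr (_ `^ _); field.
have pE : p%:R = y ^+ 24 by rewrite yX divff ?powRr1 // ltW.
have x4 : 4 <= x.
  have -> : 4 = (4 `^ E^-1) `^ E :> R.
    by rewrite -powRrM mulVf ?powRr1 // gt_eqF.
  apply: ge0_ler_powR; rewrite ?nnegrE ?powR_ge0 ?ltW //.
  apply: lt_le_trans (archi_boundP (powR_ge0 _ _)) _.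
  by rewrite ler_nat.
have x4y : x ^+ 4 <= y.
  rewrite xX; apply: ler_powR => //; lra.
have Hl : y ^+ 6 <= H%:R * x.
  rewrite -ler_pdivrMr //; apply: le_trans HlE.
  rewrite yX -powRN -qD; apply: ler_powR => //; lra.
have Hu : H%:R <= y ^+ 6 * x.
  apply: le_trans HuE _; rewrite yX -qD; apply: ler_powR => //; lra.
have Tl : y ^+ 12 <= T%:R * x.
  rewrite -ler_pdivrMr //; apply: le_trans TlE.
  rewrite yX -powRN -qD; apply: ler_powR => //; lra.
have Tu : T%:R <= y ^+ 12 * x.
  apply: le_trans TuE _; rewrite yX -qD; apply: ler_powR => //; lra.
pose D := (\max_(n < p) tau n)%N.
have tD n : (0 < n)%N -> (n < p)%N -> (tau n <= D)%N.
  by move=> _ np; exact: (leq_bigmax (F := fun n : 'I_p => tau n) (Ordinal np)).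
have Dx : D%:R <= x.
  apply: (big_ind (fun d : nat => d%:R <= x)) => [|d e dx ex|n _].
  - exact: ltW.
  - by rewrite /maxn; case: ifP.
  (* [divisors 0] is [:: 1]. *)
  - have [->|n0] := posnP n; first by apply: le_trans x4; rewrite ler_nat.
    exact: (max_tau_le (ltn0Sn _) kE p0 Cp tC).
have Hp : (H < p)%N.
  rewrite -(ltr_nat R) pE; apply: le_lt_trans Hu _.
  have y1 : 1 < y.
    apply: lt_le_trans x4y; rewrite exprn_egt1 //.
    by apply: lt_le_trans x4; rewrite ltr1n.
  apply: (@le_lt_trans _ _ (y ^+ 6 * y)).
    rewrite ler_wpM2l ?exprn_ge0 ?(ltW y0) //; apply: le_trans x4y.
    rewrite -[leLHS]expr1 ler_weXn2l //; apply: le_trans x4.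
    by rewrite ler1n.
  by rewrite -exprSr ltr_eXn2l.
rewrite -GT in Tu.
have N := ratio_pairs_bound p_prime tD x4 x4y pE Dx Tu Hu.
have S2 := char_sum_sq_le p_prime chiP chiN G a0 Hp.
set S := `|_| in S2 *.
have -> : S = (complex.Re S)%:C by rewrite RRe_real // normr_real.
rewrite lecR -(@ler_pXn2r _ 2) ?nnegrE ?mulr_ge0 ?ler0n ?powR_ge0 //; last first.
  by rewrite -lecR RRe_real ?normr_real //; exact: normr_ge0.
apply: le_trans S2 _; rewrite natrM {1}pE.
apply: (@le_trans _ _ (y ^+ 24 * (y * x ^+ 7 * H%:R))).
  by rewrite ler_wpM2l // exprn_ge0 // ltW.
have save : x ^+ 10 / y ^+ 5 <= (p%:R `^ (- 5 / 48 + eps)) ^+ 2.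
  rewrite xX yX -powRN -qD -powR_mulrn ?powR_ge0 // -powRrM.
  apply: ler_powR => //; lra.
rewrite 2!exprMn.
apply: (@le_trans _ _ (H%:R ^+ 2 * T%:R ^+ 2 * (x ^+ 10 / y ^+ 5))); last first.
  by rewrite ler_wpM2l // mulr_ge0 // sqr_ge0.
have T2 : (y ^+ 12) ^+ 2 <= (T%:R * x) ^+ 2.
  by rewrite lerXn2r ?nnegrE ?mulr_ge0 ?exprn_ge0 // ltW.
have HT : y ^+ 6 * (y ^+ 12) ^+ 2 <= H%:R * x * (T%:R * x) ^+ 2.
  by apply: ler_pM => //; rewrite ?exprn_ge0 // ltW.
have -> : y ^+ 24 * (y * x ^+ 7 * H%:R) =
    x ^+ 7 / y ^+ 5 * H%:R * (y ^+ 6 * (y ^+ 12) ^+ 2).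
  by field; rewrite gt_eqF.
have -> : H%:R ^+ 2 * T%:R ^+ 2 * (x ^+ 10 / y ^+ 5) =
    x ^+ 7 / y ^+ 5 * H%:R * (H%:R * x * (T%:R * x) ^+ 2).
  by field; rewrite gt_eqF.
by rewrite ler_wpM2l // mulr_ge0 // divr_ge0 // exprn_ge0 // ltW.
Qed.
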